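(* Let $P$ denote the set of all primes and let $G$ be a torsion-free abelian group of finite rank $n$. Choose a maximal independent set $\{g_1,\ldots,g_n\}\subset G$ and, for each $p\in P$, a $\mathbb{Z}_p$-basis $\{f_1^{(p)},\ldots,f_{n_p}^{(p)}\}$ of $G^{*p}$. For each $p\in P$, let $A_p = (f_i^{(p)}(g_j))\in M_{n_p\times n}(\mathbb{Z}_p)$. Then $G$ is isomorphic to $$\mathcal{G}((A_p)_{p\in P}) := \{v\in\mathbb{Q}^n : A_pv\in\mathbb{Z}_p^{n_p}\text{ for all }p\in P\}.$$
   Context: $\mathbb{Z}_p$ denotes the $p$-adic integers. The rank of a torsion-free abelian group is the size of any maximal ($\mathbb{Z}$-linearly) independent subset. $G^{*p}=\mathrm{Hom}(G,\mathbb{Z}_p)$ is the group of all group homomorphisms $G\to\mathbb{Z}_p$; it is a $\mathbb{Z}_p$-module, which for $G$ of finite rank $n$ is free of finite rank $n_p\le n$ (if $n_p=0$, the condition $A_pv\in\mathbb{Z}_p^{n_p}$ is vacuous). *)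

(* Defs.v *)
From HB Require Import structures.
From mathcomp Require Import all_boot all_order all_algebra.
From mathcomp Require Import boolp classical_sets functions cardinality.

Set Implicit Arguments.
Unset Strict Implicit.
Unset Printing Implicit Defensive.

Import GRing.Theory.
Local Open Scope ring_scope.

Definition primes_type : Type := {p : nat | prime p}.

Section PadicInt.
Variable p : primes_type.
Local Notation q k := (val p ^ k.+1)%N.

Lemma primes_exp_gt1 k : (1 < q k)%N.
Proof. by rewrite -(exp1n k.+1) ltn_exp2r // prime_gt1 // (valP p). Qed.

(* The inverse limit of the rings Z/p^(k+1), k >= 0. The exponent is shifted
   because 'Z_1 is not the zero ring in MathComp. *)
Record padic_int : Type := PadicInt {
  pcoord : forall k : nat, 'Z_(q k);
  pcoord_compat : forall k, (pcoord k.+1 = pcoord k %[mod q k])%N }.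

Lemma padic_ext (x y : padic_int) : (forall k, pcoord x k = pcoord y k) -> x = y.
Proof.
case: x y => [x hx] [y hy] /= xy.
have e : x = y by apply: functional_extensionality_dep.
by subst y; congr PadicInt; exact: Prop_irrelevance.
Qed.

HB.instance Definition _ := gen_eqMixin padic_int.
HB.instance Definition _ := gen_choiceMixin padic_int.

Lemma Zq_add k (a b : 'Z_(q k)) : (a + b)%R = ((a + b)%N %% q k)%N :> nat.
Proof. by congr (_ %% _)%N; rewrite Zp_cast // primes_exp_gt1. Qed.

Lemma Zq_mul k (a b : 'Z_(q k)) : (a * b)%R = ((a * b)%N %% q k)%N :> nat.
Proof. by congr (_ %% _)%N; rewrite Zp_cast // primes_exp_gt1. Qed.

Lemma Zq_lt k (a : 'Z_(q k)) : (a < q k)%N.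
Proof. by apply: leq_trans (ltn_ord a) _; rewrite Zp_cast // primes_exp_gt1. Qed.

Lemma dvd_q k : (q k %| q k.+1)%N.
Proof. by rewrite dvdn_exp2l. Qed.

Lemma q_gt0 k : (0 < q k)%N.
Proof. exact: ltnW (primes_exp_gt1 k). Qed.

Fact padic0_compat k : 
  ((0 : 'Z_(q k.+1))%R = (0 : 'Z_(q k))%R %[mod q k])%N.
Proof. by []. Qed.
Definition padic0 := PadicInt padic0_compat.

Fact padic1_compat k : 
  ((1 : 'Z_(q k.+1))%R = (1 : 'Z_(q k))%R %[mod q k])%N.
Proof. by []. Qed.
Definition padic1 := PadicInt padic1_compat.

Fact padic_add_compat (x y : padic_int) k :
  ((pcoord x k.+1 + pcoord y k.+1)%R = (pcoord x k + pcoord y k)%R %[mod q k])%N.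
Proof.
rewrite !Zq_add (modn_dvdm _ (dvd_q k)) modn_mod -modnDm.
by rewrite !pcoord_compat modnDm.
Qed.
Definition padic_add x y := PadicInt (padic_add_compat x y).

Fact padic_mul_compat (x y : padic_int) k :
  ((pcoord x k.+1 * pcoord y k.+1)%R = (pcoord x k * pcoord y k)%R %[mod q k])%N.
Proof.
rewrite !Zq_mul (modn_dvdm _ (dvd_q k)) modn_mod -modnMm.
by rewrite !pcoord_compat modnMm.
Qed.
Definition padic_mul x y := PadicInt (padic_mul_compat x y).

Fact padic_opp_compat (x : padic_int) k :
  ((- pcoord x k.+1)%R = (- pcoord x k)%R %[mod q k])%N.
Proof.
have oppE j : (((- pcoord x j)%R + pcoord x j)%N %% q j = 0)%N.
  by rewrite -Zq_add addNr.
apply/eqP; rewrite -(eqn_modDr (pcoord x k)) oppE.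
rewrite -modnDmr -pcoord_compat modnDmr -(modn_dvdm _ (dvd_q k)) oppE.
by rewrite mod0n.
Qed.
Definition padic_opp x := PadicInt (padic_opp_compat x).

Fact padic_addA : associative padic_add.
Proof. by move=> x y z; apply: padic_ext => k; exact: addrA. Qed.
Fact padic_addC : commutative padic_add.
Proof. by move=> x y; apply: padic_ext => k; exact: addrC. Qed.
Fact padic_add0 : left_id padic0 padic_add.
Proof. by move=> x; apply: padic_ext => k; exact: add0r. Qed.
Fact padic_addN : left_inverse padic0 padic_opp padic_add.
Proof. by move=> x; apply: padic_ext => k; exact: addNr. Qed.

HB.instance Definition _ := GRing.isZmodule.Build padic_int
  padic_addA padic_addC padic_add0 padic_addN.

Fact padic_mulA : associative padic_mul.
Proof. by move=> x y z; apply: padic_ext => k; exact: mulrA. Qed.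
Fact padic_mulC : commutative padic_mul.
Proof. by move=> x y; apply: padic_ext => k; exact: mulrC. Qed.
Fact padic_mul1 : left_id padic1 padic_mul.
Proof. by move=> x; apply: padic_ext => k; exact: mul1r. Qed.
Fact padic_mulD : left_distributive padic_mul padic_add.
Proof. by move=> x y z; apply: padic_ext => k; exact: mulrDl. Qed.
Fact padic1_neq0 : padic1 != 0.
Proof. by apply/eqP => /(congr1 (fun x : padic_int => pcoord x 0%N : nat)). Qed.

HB.instance Definition _ := GRing.Zmodule_isComNzRing.Build padic_int
  padic_mulA padic_mulC padic_mul1 padic_mulD padic1_neq0.

Definition padic_unit : {pred padic_int} :=
  fun x => `[< exists y : padic_int, y * x = 1 >].
Definition padic_inv (x : padic_int) : padic_int :=
  if pselect (exists y, y * x = 1) is left e then projT1 (cid e) else x.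

Fact padic_mulV : {in padic_unit, left_inverse 1 padic_inv *%R}.
Proof.
move=> x /asboolP ux; rewrite /padic_inv.
by case: pselect => // e; case: cid.
Qed.
Fact padic_unitP (x y : padic_int) : y * x = 1 -> padic_unit x.
Proof. by move=> yx; apply/asboolP; exists y. Qed.
Fact padic_inv_out : {in [predC padic_unit], padic_inv =1 id}.
Proof.
move=> x /negP nx; rewrite /padic_inv; case: pselect => // e.
by case: nx; apply/asboolP.
Qed.

HB.instance Definition _ := GRing.ComNzRing_hasMulInverse.Build padic_int
  padic_mulV padic_unitP padic_inv_out.

Lemma pcoord_modD (x : padic_int) k l : 
  (pcoord x (l + k) = pcoord x k %[mod q k])%N.
Proof.
elim: l => [//|l IH]; rewrite -{}IH addSn.
have d : (q k %| q (l + k))%N by rewrite dvdn_exp2l // ltnS leq_addl.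
by rewrite -(modn_dvdm _ d) pcoord_compat modn_dvdm.
Qed.

Lemma padic_neq0 (x : padic_int) :
  x != 0 -> exists k, ~~ (q k %| pcoord x k)%N.
Proof.
move=> /eqP x0; apply: contrapT => h; apply: x0; apply: padic_ext => k.
apply: val_inj => /=; apply: contrapT => /eqP xk; apply: h; exists k => //.
by rewrite gtnNdvd ?Zq_lt // lt0n.
Qed.

Fact padic_idomain (x y : padic_int) : x * y = 0 -> (x == 0) || (y == 0).
Proof.
move=> xy; apply: contrapT => /negP; rewrite negb_or => /andP[].
move=> /padic_neq0[k xk] /padic_neq0[l yl].
have pp : prime (val p) := valP p.
set N := (k + l.+1)%N.
have xN : ~~ (q k %| pcoord x N)%N.
  by rewrite /N addnC /dvdn pcoord_modD.
have yN : ~~ (q l %| pcoord y N)%N.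
  by rewrite /N -addSnnS /dvdn pcoord_modD.
have x0 : (0 < pcoord x N)%N by rewrite lt0n; apply: contra xN => /eqP ->.
have y0 : (0 < pcoord y N)%N by rewrite lt0n; apply: contra yN => /eqP ->.
have := congr1 (fun z : padic_int => pcoord z N : nat) xy.
rewrite [LHS]Zq_mul /= => /eqP; rewrite -/(dvdn _ _).
rewrite pfactor_dvdn ?muln_gt0 ?x0 // lognM // => h.
move: xN yN; rewrite !pfactor_dvdn // -!ltnNge !ltnS => hx hy.
by move: (leq_trans h (leq_add hx hy)); rewrite /N addnS ltnNge leqnSn.
Qed.

HB.instance Definition _ :=
  GRing.ComUnitRing_isIntegral.Build padic_int padic_idomain.

Lemma pcoord_nat n k : pcoord (n%:R : padic_int) k = n%:R.
Proof. by elim: n => [//|n IH]; rewrite !mulrS -IH. Qed.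

Lemma padic_natr_eq0 n : (n%:R == 0 :> padic_int) = (n == 0%N).
Proof.
apply/eqP/eqP => [h|-> //].
have := congr1 (fun z : padic_int => pcoord z n : nat) h.
rewrite pcoord_nat val_Zp_nat ?primes_exp_gt1 // => /= /eqP.
rewrite -/(dvdn _ _); case: n {h} => // n /dvdn_leq -/(_ isT).
by rewrite leqNgt (leq_trans (ltnSn _)) // ltnW // ltn_expl // prime_gt1 // (valP p).
Qed.

Definition padic_num : fieldType := {fraction padic_int}.

Lemma padic_num_intr_eq0 (z : int) : (z%:~R == 0 :> padic_num) = (z == 0).
Proof.
have h n : (n%:R == 0 :> padic_num) = (n == 0%N).
  by rewrite -(rmorph_nat (@tofrac padic_int)) tofrac_eq0 padic_natr_eq0.
by case: z => n; rewrite ?NegzE ?mulrNz ?oppr_eq0; exact: h.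
Qed.

Fact ratr_padic_zmod_morphism : zmod_morphism (@ratr padic_num).
Proof.
have injZtoQ : @injective rat int intr by apply: intr_inj.
have nz_den x : (denq x)%:~R != 0 :> padic_num.
  by rewrite padic_num_intr_eq0 denq_eq0.
move=> x y.
apply: (canLR (mulfK (nz_den _))); apply: (mulIf (nz_den x)).
rewrite mulrAC mulrBl divfK ?nz_den // mulrAC -!rmorphM.
apply: (mulIf (nz_den y)); rewrite mulrAC mulrBl divfK ?nz_den //.
rewrite -!(rmorphM, rmorphB); congr _%:~R; apply: injZtoQ.
rewrite !(rmorphM, rmorphB) /= [_ - _]lock /= -lock !numqE.
by rewrite (mulrAC y) -!mulrBl -mulrA mulrAC !mulrA.
Qed.

(* A separate constant: ratr already keys an instance over numFieldType. *)
Definition padic_of_rat (x : rat) : padic_num := ratr x.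

HB.instance Definition _ := GRing.isZmodMorphism.Build rat padic_num
  padic_of_rat ratr_padic_zmod_morphism.

End PadicInt.

Section PadicDual.
Variables (G : zmodType) (p : primes_type).

Definition padic_dual : Type := {additive G -> padic_int p}.

Implicit Types (f h : padic_dual) (a : padic_int p).

Lemma padic_dual_ext f h : (forall x, f x = h x) -> f = h.
Proof.
case: f h => [f [[cf]]] [h [[ch]]] /= fh.
have e : f = h by apply: functional_extensionality_dep.
by subst h; rewrite (Prop_irrelevance cf ch).
Qed.

HB.instance Definition _ := gen_eqMixin padic_dual.
HB.instance Definition _ := gen_choiceMixin padic_dual.

Fact dual_scale_zmod_morphism a f : zmod_morphism (fun x => a * f x).
Proof. by move=> x y; rewrite raddfB mulrBr. Qed.

Definition dual_zero : padic_dual := \0.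
Definition dual_add f h : padic_dual := f \+ h.
Definition dual_opp f : padic_dual := \- f.
Definition dual_scale a f : padic_dual := HB.pack (fun x => a * f x)
  (GRing.isZmodMorphism.Build G (padic_int p) _ (dual_scale_zmod_morphism a f)).

Fact dual_addA : associative dual_add.
Proof. by move=> u v w; apply: padic_dual_ext => x; exact: addrA. Qed.
Fact dual_addC : commutative dual_add.
Proof. by move=> u v; apply: padic_dual_ext => x; exact: addrC. Qed.
Fact dual_add0 : left_id dual_zero dual_add.
Proof. by move=> u; apply: padic_dual_ext => x; exact: add0r. Qed.
Fact dual_addN : left_inverse dual_zero dual_opp dual_add.
Proof. by move=> u; apply: padic_dual_ext => x; exact: addNr. Qed.

HB.instance Definition _ := GRing.isZmodule.Build padic_dual
  dual_addA dual_addC dual_add0 dual_addN.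

Fact dual_scaleA a b f : dual_scale a (dual_scale b f) = dual_scale (a * b) f.
Proof. by apply: padic_dual_ext => x; exact: mulrA. Qed.
Fact dual_scale1 : left_id 1 dual_scale.
Proof. by move=> u; apply: padic_dual_ext => x; exact: mul1r. Qed.
Fact dual_scaleDr : right_distributive dual_scale +%R.
Proof. by move=> a u v; apply: padic_dual_ext => x; exact: mulrDr. Qed.
Fact dual_scaleDl f : {morph dual_scale^~ f : a b / a + b}.
Proof. by move=> a b; apply: padic_dual_ext => x; exact: mulrDl. Qed.

HB.instance Definition _ := GRing.Zmodule_isLmodule.Build (padic_int p)
  padic_dual dual_scaleA dual_scale1 dual_scaleDr dual_scaleDl.

End PadicDual.

Definition is_basis (R : pzRingType) (M : lmodType R) (m : nat) (b : 'I_m -> M) :=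
  (forall c : 'I_m -> R, \sum_(i < m) c i *: b i = 0 -> forall i, c i = 0) /\
  (forall x : M, exists c : 'I_m -> R, x = \sum_(i < m) c i *: b i).

Section TorsionFree.
Variable G : zmodType.
Local Open Scope classical_set_scope.

Definition torsion_free :=
  forall (x : G) (k : nat), (0 < k)%N -> x *+ k = 0 -> x = 0.

Definition zindependent (S : set G) :=
  forall (k : nat) (x : 'I_k -> G) (c : 'I_k -> int),
    injective x -> (forall i, S (x i)) ->
    \sum_(i < k) x i *~ c i = 0 -> forall i, c i = 0.

Definition maximal_independent (S : set G) :=
  zindependent S /\ forall T : set G, zindependent T -> S `<=` T -> T = S.

Definition has_rank (n : nat) :=
  exists2 S : set G, maximal_independent S & (S #= `I_n)%card.

End TorsionFree.

Definition group_isomorphic (U V : zmodType) :=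
  exists phi : {additive U -> V}, bijective phi.

Section Realization.
Variables (n : nat) (m : primes_type -> nat).
Variable A : forall p : primes_type, 'M[padic_int p]_(m p, n).

(* The product A_p v is formed over the field of p-adic numbers, into which the
   entries of both A_p and v are mapped. *)
Definition padic_integral_at (p : primes_type) (v : 'cV[rat]_n) :=
  exists w : 'cV[padic_int p]_(m p),
    map_mx (@tofrac (padic_int p)) (A p) *m map_mx (@padic_of_rat p) v
    = map_mx (@tofrac (padic_int p)) w.

Definition matrix_group_pred : {pred 'cV[rat]_n} :=
  fun v => `[< forall p, padic_integral_at p v >].

Fact matrix_group_zmod_closed : zmod_closed matrix_group_pred.
Proof.
split.
  by apply/asboolP => p; exists 0; rewrite !map_mx0 mulmx0.
move=> u v /asboolP hu /asboolP hv; apply/asboolP => p.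
have [[a ua] [b vb]] := (hu p, hv p); exists (a - b).
by rewrite !map_mxB mulmxBr ua vb.
Qed.

HB.instance Definition _ :=
  GRing.isZmodClosed.Build 'cV[rat]_n matrix_group_pred matrix_group_zmod_closed.

Definition matrix_group : Type := {v : 'cV[rat]_n | v \in matrix_group_pred}.

HB.instance Definition _ := SubType.on matrix_group.
HB.instance Definition _ := Choice.on matrix_group.
HB.instance Definition _ := [SubChoice_isSubZmodule of matrix_group by <:].

End Realization.

(* Main.v *)
From HB Require Import structures.
Require Import Defs.
From mathcomp Require Import all_boot all_order all_algebra.
From mathcomp Require Import boolp classical_sets functions cardinality.

Set Implicit Arguments.
Unset Strict Implicit.
Unset Printing Implicit Defensive.

Import GRing.Theory.
Local Open Scope ring_scope.

(** Coordinates with respect to g embed G into Q^n, and A_p maps the coordinates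
    of x to the values f_i(x), so the image lies in the matrix group. Conversely,
    let v be in the matrix group, N v integral and y = sum_j (N v)_j g_j. Then
    h(y) is divisible by N for every prime p and every h : G -> Z_p, and it
    suffices to show y in N G, hence, one prime factor at a time, that y is in
    p G as soon as h(y) is in p Z_p for all h. If y is not in p G, extend y to a
    maximal family independent modulo p G. It has at most n members and spans G
    modulo p^k G with coordinates unique modulo p^k, for all k; the y-coordinates
    assemble into some h with h(y) = 1. *)

(** * Linear independence modulo p *)

Section PIndependence.
Variables (G : zmodType) (p : primes_type).
Hypothesis Gtf : torsion_free G.
Local Notation q := (val p).

Lemma torsion_free_mulrnI (k : nat) (x y : G) :
  (0 < k)%N -> x *+ k = y *+ k -> x = y.
Proof.
move=> k0 /eqP; rewrite -subr_eq0 -mulrnBl => /eqP /Gtf - /(_ k0) /eqP.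
by rewrite subr_eq0 => /eqP.
Qed.

(** Families are indexed by [nat] with a separate length [d], so that lengthening one needs no
    change of index type. *)
Definition lincomb (d : nat) (b : nat -> G) (c : nat -> int) : G :=
  \sum_(i < d) b i *~ c i.

Lemma lincombB d b c e :
  lincomb d b (fun i => c i - e i) = lincomb d b c - lincomb d b e.
Proof. by rewrite /lincomb -sumrB; apply: eq_bigr => i _; rewrite mulrzBr. Qed.

Lemma lincombD d b c e :
  lincomb d b (fun i => c i + e i) = lincomb d b c + lincomb d b e.
Proof. by rewrite /lincomb -big_split; apply: eq_bigr => i _; rewrite mulrzDr. Qed.

Lemma lincombMz d b c (a : int) :
  lincomb d b (fun i => c i * a) = lincomb d b c *~ a.
Proof. by rewrite /lincomb mulrz_suml; apply: eq_bigr => i _; rewrite mulrzA. Qed.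

(** This is linear independence over F_p of the images in G/pG. *)
Definition pindep (d : nat) (b : nat -> G) :=
  forall (c : nat -> int) (x : G), lincomb d b c = x *+ q ->
  forall i, (i < d)%N -> (q%:Z %| c i)%Z.

(** All coefficients are divisible by p; torsion-freeness cancels one factor p, and the quotients
    satisfy the relation with exponent lowered by one. *)
Lemma pindep_exp d b k (c : nat -> int) (x : G) :
  pindep d b -> lincomb d b c = x *+ q ^ k ->
  forall i, (i < d)%N -> ((q ^ k)%N%:Z %| c i)%Z.
Proof.
move=> ib; elim: k c x => [|k IH] c x h i id; first by rewrite expn0 dvd1z.
have dc j : (j < d)%N -> (q%:Z %| c j)%Z.
  by apply: (ib _ (x *+ q ^ k)); rewrite -mulrnA -expnSr.
have cE : lincomb d b c = lincomb d b (fun j => (c j %/ q%:Z)%Z) *+ q.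
  rewrite pmulrn -lincombMz; apply: eq_bigr => j _.
  by rewrite divzK // dc.
have h' : lincomb d b (fun j => (c j %/ q%:Z)%Z) = x *+ q ^ k.
  apply: (@torsion_free_mulrnI q); first exact/prime_gt0/(valP p).
  by rewrite -cE h -mulrnA -expnSr.
by rewrite -(divzK (dc _ id)) expnSr PoszM dvdz_mul // (IH _ _ h').
Qed.

(** Zero lies in p^k G for every k. Taking k = |c_i| makes p^k divide c_i, while p^k > |c_i|. *)
Lemma pindep_indep d b (c : nat -> int) :
  pindep d b -> lincomb d b c = 0 -> forall i, (i < d)%N -> c i = 0.
Proof.
move=> ib h i id; apply/eqP; rewrite -absz_eq0.
have : ((q ^ `|c i|)%N%:Z %| c i)%Z.
  by apply: (@pindep_exp d b `|c i|%N c 0) => //; rewrite mul0rn.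
rewrite dvdzE /=; case: (`|c i|%N) => // t /dvdn_leq - /(_ isT).
by rewrite leqNgt ltn_expl // prime_gt1 // (valP p).
Qed.

Definition pspan (d : nat) (b : nat -> G) (x : G) :=
  exists (c : nat -> int) (u : G), x = lincomb d b c + u *+ q.

(** A coefficient of [x] prime to p would be invertible modulo p and put [x] in the span. So p
    divides it, and its term moves into the multiple of p. *)
Lemma pindep_extend d (b : nat -> G) (x : G) :
  pindep d b -> ~ pspan d b x ->
  pindep d.+1 (fun i => if (i < d)%N then b i else x).
Proof.
move=> ib nx c u; rewrite /lincomb big_ord_recr /= ltnn.
under eq_bigr => i _ do rewrite ltn_ord.
rewrite -/(lincomb d b c) => h.
have dq : (q%:Z %| c d)%Z.
  apply: contrapT => /negP; rewrite dvdzE /= -prime_coprime; last exact: (valP p).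
  have -> : coprime q `|c d| = coprimez (c d) q by rewrite coprimezE coprime_sym.
  move=> /coprimezP[[s t] /= st]; apply: nx.
  (* Bezout gives x = s c_d x + t p x, and the relation expresses c_d x through [u] and [b]. *)
  exists (fun i => c i * - s), (u *~ s + x *~ t).
  rewrite lincombMz -[LHS]mulr1z -st mulrzDr mulrnDl.
  have -> : x *~ (s * c d) = (u *+ q - lincomb d b c) *~ s.
    by rewrite -h addrAC subrr add0r -mulrzA mulrC.
  rewrite mulrzBl mulrNz mulrzA !pmulrn -!mulrzA (mulrC q%:Z s).
  by rewrite addrAC addrA addrC addrA.
move=> i; rewrite ltnS leq_eqVlt => /orP[/eqP -> //|id].
have := ib c (u - x *~ (c d %/ q%:Z)%Z); apply => //.
by rewrite mulrnBl -h !pmulrn -mulrzA divzK // addrK.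
Qed.

End PIndependence.

(** * Maximal independent sets and the bound on p-independent families *)

Section Rank.
Variables (G : zmodType) (n : nat) (g : 'I_n -> G).
Hypothesis g_inj : injective g.
Hypothesis g_max : maximal_independent (range g).

Definition zspan (z : 'cV[int]_n) : G := \sum_j g j *~ z j 0.

Fact zspan_zmod_morphism : zmod_morphism zspan.
Proof.
by move=> u v; rewrite /zspan -sumrB; apply: eq_bigr => j _; rewrite !mxE mulrzBr.
Qed.
HB.instance Definition _ := GRing.isZmodMorphism.Build _ _ zspan zspan_zmod_morphism.

Lemma zspan_eq0 z : zspan z = 0 -> z = 0.
Proof.
case: g_max => gi _ h; apply/matrixP => i j; rewrite ord1 mxE.
by apply: (gi n g (fun j => z j 0)) => // l; exists l.
Qed.

(** Terms with coefficient zero are unconstrained, so an element outside [range g] can be masked by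
    a zero coefficient. *)
Lemma range_lincomb_zspan k (x : 'I_k -> G) (c : 'I_k -> int) :
  (forall i, c i != 0 -> range g (x i)) -> exists z, \sum_i x i *~ c i = zspan z.
Proof.
move=> h.
have /choice[z zE] i : exists z, x i *~ c i = zspan z.
  have [-> | /h[j _ <-]] := eqVneq (c i) 0; first by exists 0; rewrite mulr0z raddf0.
  exists (c i *: delta_mx j 0); rewrite /zspan (bigD1 j) //= big1 ?addr0 => [|l lj].
    by rewrite !mxE !eqxx mulr1.
  by rewrite !mxE (negPf lj) mulr0.
by exists (\sum_i z i); rewrite raddf_sum; apply: eq_bigr => i _.
Qed.

(** If no nonzero multiple of [x] were in the span of g, adjoining [x] would keep independence;
    maximality would then put [x] in [range g], a contradiction. *)
Lemma torsion_over_zspan (x : G) :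
  exists (N : nat) (z : 'cV[int]_n), (0 < N)%N /\ x *+ N = zspan z.
Proof.
case: g_max => gi gm; apply: contrapT => nx.
have nxz (a : int) (z : 'cV[int]_n) : x *~ a = zspan z -> a = 0.
  case: a => [[|N]|N] // h; case: nx; [exists N.+1, z|exists N.+1, (- z)]; split=> //.
  by rewrite raddfN /= -h NegzE mulrNz opprK.
suff xg : range g x.
  case: xg => j _ gx; have := nxz 1 (delta_mx j 0); rewrite mulr1z -gx.
  suff -> : zspan (delta_mx j 0) = g j by move=> /(_ erefl).
  rewrite /zspan (bigD1 j) //= big1 ?addr0 ?mxE ?eqxx // => l lj.
  by rewrite mxE (negPf lj).
suff <- : (range g `|` [set x] = range g)%classic by right.
apply: gm; last by move=> y; left.
move=> k y c yi yT h.
(* All other terms of the relation lie in the span of g, hence so does c_i x. *)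
have cx i : y i = x -> c i = 0.
  move=> yx.
  have [z zE] : exists z, \sum_(l < k) y l *~ (if l == i then 0 else c l) = zspan z.
    apply: range_lincomb_zspan => l; have [//|/eqP li _] := eqVneq l i.
    by case: (yT l) => //= /esym yl; case: li; apply: yi; rewrite yx.
  apply: (nxz (c i) (- z)); rewrite raddfN /= -zE; apply/eqP; rewrite -addr_eq0.
  apply/eqP; rewrite -[RHS]h (bigD1 i) //= eqxx mulr0z add0r [RHS](bigD1 i) //= yx.
  by congr (_ + _); apply: eq_bigr => l /negPf ->.
have [[i yx]|nyx] := pselect (exists i, y i = x); last first.
  by apply: gi h => // i; case: (yT i) => // yx; case: nyx; exists i.
have ck := cx _ yx.
(* With [k] a successor, [lift] removes the index of [x]; what remains is a relation within
   [range g]. *)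
case: k i y c yi yT h cx yx ck => [[]//|k] i y c yi yT h cx yx ck.
move: h; rewrite (bigD1_ord i) //= ck mulr0z add0r => h l.
have [j ->|-> //] := unliftP i l.
  apply: (gi k (y \o lift i) (c \o lift i)) h _ => [|r /=].
    exact: inj_comp yi lift_inj.
  case: (yT (lift i r)) => //= yr; have /eqP := neq_lift i r.
  by case; apply: yi; rewrite yx yr.
Qed.

(** Multiples of the d elements have coordinate rows in Q^n; as d > n these rows are dependent, and
    denominators can be cleared. *)
Lemma lincomb_dependent d (b : nat -> G) : torsion_free G -> (n < d)%N ->
  exists c : nat -> int, lincomb d b c = 0 /\ exists2 i, (i < d)%N & c i != 0.
Proof.
move=> Gtf nd.
have /choice[Nz NzE] (i : nat) : exists Nz : nat * 'cV[int]_n,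
    (0 < Nz.1)%N /\ b i *+ Nz.1 = zspan Nz.2.
  by have [N [z]] := torsion_over_zspan (b i); exists (N, z).
pose M : 'M[rat]_(d, n) := \matrix_(i, j) ((Nz i).2 j 0)%:~R.
have : kermx M != 0.
  by rewrite kermx_eq0 /row_free neq_ltn (leq_ltn_trans (rank_leq_col M) nd).
case/rowV0Pn => u /sub_kermxP uM u0.
(* [a] is [u] times the product of all its denominators, with default 0 beyond [d]. *)
pose a i : int := if insub i is Some o then
  numq (u 0 o) * \prod_(l < d | l != o) denq (u 0 l) else 0.
have aE (i : 'I_d) : (a i)%:~R = u 0 i * (\prod_(l < d) denq (u 0 l))%:~R :> rat.
  rewrite /a valK rmorphM /= numqE -mulrA -rmorphM.
  by rewrite [in RHS](bigD1 i).
(* The factor [(Nz i).1] brings [b i] into the span of g. *)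
exists (fun i => (Nz i).1%:Z * a i); split.
  rewrite /lincomb; under eq_bigr => i _ do
    rewrite mulrzA -pmulrn (NzE i).2 -raddfMz.
  rewrite -raddf_sum (_ : \sum_i _ = 0) ?raddf0 //.
  apply/matrixP => j k; rewrite ord1 mxE summxE; apply: (@intr_inj rat).
  have E : (\sum_i u 0 i * M i j) * (\prod_(l < d) denq (u 0 l))%:~R = 0.
    by have := congr1 (fun B : 'rV_n => B 0 j) uM; rewrite !mxE => ->; rewrite mul0r.
  rewrite rmorph_sum /= rmorph0 -[RHS]E mulr_suml; apply: eq_bigr => i _.
  rewrite !mxE -scaler_int mxE rmorphM /= intz aE.
  by rewrite mulrAC.
have [i ui] : exists i, u 0 i != 0.
  apply: contrapT => h; case/eqP: u0; apply/rowP => i; rewrite mxE.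
  by apply/eqP; apply: contrapT => /negP ui; apply: h; exists i.
exists i => //; rewrite mulf_neq0 //.
  by rewrite -lt0n; case: (NzE i).
rewrite -(intr_eq0 rat) aE mulf_neq0 // intr_eq0.
by apply/prodf_neq0 => l _; rewrite denq_eq0.
Qed.

Lemma pindep_leq_rank (p : primes_type) d (b : nat -> G) :
  torsion_free G -> pindep p d b -> (d <= n)%N.
Proof.
move=> Gtf ib; rewrite leqNgt; apply/negP => nd.
have [c [c0 [i id /eqP ci]]] := lincomb_dependent b Gtf nd.
exact: ci (pindep_indep Gtf ib c0 id).
Qed.

End Rank.

(** * Construction of homomorphisms into the p-adic integers *)

Section PadicDualExistence.
Variable p : primes_type.
Local Notation q := (val p).

Lemma pcoord_int (z : int) k : pcoord (z%:~R : padic_int p) k = z%:~R.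
Proof.
case: z => m; first exact: pcoord_nat.
by rewrite NegzE !mulrNz -[m.+1%:Z%:~R in RHS](pcoord_nat p).
Qed.

Lemma Zq_intr_eq (k : nat) (a b : int) :
  ((q ^ k.+1)%N%:Z %| a - b)%Z -> a%:~R = b%:~R :> 'Z_(q ^ k.+1).
Proof.
move=> /dvdzP[t abt]; apply/eqP; rewrite -subr_eq0 -rmorphB /= abt rmorphM /=.
by rewrite -pmulrn pchar_Zp ?mulr0 // primes_exp_gt1.
Qed.

Variables (G : zmodType).
Hypothesis Gtf : torsion_free G.

Section PadicCoordinates.
Variables (d : nat) (b : nat -> G).
Hypothesis b_indep : pindep p d b.
Hypothesis b_span : forall x, pspan p d b x.

(** Expanding the remainder [u] again modulo p gains one power of p. *)
Lemma pspan_exp k (x : G) :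
  exists (c : nat -> int) (u : G), x = lincomb d b c + u *+ q ^ k.
Proof.
elim: k => [|k [c [u ->]]].
  by exists (fun=> 0), x; rewrite expn0 mulr1n /lincomb big1 ?add0r.
have [c' [u' ->]] := b_span u.
exists (fun i => c i + c' i * (q ^ k)%N%:Z), u'.
by rewrite lincombD lincombMz mulrnDl addrA -mulrnA -expnS.
Qed.

Lemma pspan_coord_unique k (c c' : nat -> int) (u u' : G) :
  lincomb d b c + u *+ q ^ k = lincomb d b c' + u' *+ q ^ k ->
  forall i, (i < d)%N -> ((q ^ k)%N%:Z %| c i - c' i)%Z.
Proof.
move=> h; apply: (pindep_exp Gtf (c := fun i => c i - c' i) (x := u' - u) b_indep).
rewrite lincombB mulrnBl; apply/eqP.
by rewrite subr_eq addrAC eq_sym subr_eq h addrC.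
Qed.

Lemma coordinate_dual : (0 < d)%N -> exists h : padic_dual G p, h (b 0%N) = 1.
Proof.
move=> d0.
have /choice[c cE] (kx : nat * G) : exists c u, kx.2 = lincomb d b c + u *+ q ^ kx.1.
  exact: pspan_exp.
(* [pcoord] at k lives modulo p^(k+1), hence the shifted exponent. *)
pose a k x : padic_int p := (c (k.+1, x) 0%N)%:~R.
have compat x k : (pcoord (a k.+1 x) k.+1 = pcoord (a k x) k %[mod q ^ k.+1])%N.
  rewrite pcoord_compat !pcoord_int; congr (nat_of_ord _ %% _)%N; apply: Zq_intr_eq.
  have [[u uE] [v vE]] := (cE (k.+1, x), cE (k.+2, x)).
  apply: (pspan_coord_unique (u := v *+ q) (u' := u)) => //.
  by rewrite -uE -mulrnA -expnS -vE.
pose h x := PadicInt (compat x).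
(* By uniqueness any expansion computes [h], not only the chosen one; additivity and the value at
   [b 0] follow from convenient expansions. *)
have hE x c' u k : x = lincomb d b c' + u *+ q ^ k.+1 -> pcoord (h x) k = (c' 0%N)%:~R.
  move=> xE; rewrite /= pcoord_int; apply: Zq_intr_eq.
  have [v vE] := cE (k.+1, x).
  by apply: (pspan_coord_unique (u := v) (u' := u)) => //; rewrite -vE.
have hB : zmod_morphism h.
  move=> x y; apply: padic_ext => k.
  have [[u uE] [v vE]] := (cE (k.+1, x), cE (k.+1, y)).
  rewrite (hE _ (fun i => c (k.+1, x) i - c (k.+1, y) i) (u - v)).
    by rewrite rmorphB /= !pcoord_int.
  by rewrite lincombB mulrnBl addrACA -opprD -uE -vE.
pose H : padic_dual G p := HB.pack h (GRing.isZmodMorphism.Build G (padic_int p) h hB).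
exists H; apply: padic_ext => k.
rewrite [pcoord _ _](hE _ (fun i => (i == 0%N)%:R) 0) //.
rewrite mul0rn addr0 /lincomb (bigD1 (Ordinal d0)) //= big1 ?addr0 // => i.
by rewrite -val_eqE /= => /negPf ->; rewrite mulr0z.
Qed.

End PadicCoordinates.

Lemma exists_padic_dual n (y : G) :
  (forall d (b : nat -> G), pindep p d b -> (d <= n)%N) -> ~ (exists u, y = u *+ q) ->
  exists h : padic_dual G p, h y = 1.
Proof.
move=> bd ny.
(* The family has d+1 members, so [y] always occupies position 0. *)
pose P d := `[< exists b : nat -> G, b 0%N = y /\ pindep p d.+1 b >].
have P0 : exists d, P d.
  (* The constant family is written in the shape produced by extending the empty family by [y]. *)
  exists 0%N; apply/asboolP; exists (fun i => if (i < 0)%N then y else y); split=> //.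
  apply: (@pindep_extend _ _ 0 (fun=> y)) => // -[c [u]].
  by rewrite /lincomb big_ord0 add0r => yu; apply: ny; exists u.
have Pn d : P d -> (d <= n)%N by move=> /asboolP[b [_ /bd /ltnW]].
case: (ex_maxnP P0 Pn) => d /asboolP[b [by0 ib]] dmax.
rewrite -by0; apply: (coordinate_dual ib) => // x; apply: contrapT => nx.
(* An element outside the span would lengthen the family, against maximality of [d]. *)
suff /dmax : P d.+1 by rewrite ltnn.
by apply/asboolP; exists (fun i => if (i < d.+1)%N then b i else x); split;
  last exact: pindep_extend.
Qed.

Lemma padic_dual_dvdp n (y : G) :
  (forall d (b : nat -> G), pindep p d b -> (d <= n)%N) ->
  (forall h : padic_dual G p, exists w, h y = w *+ q) -> exists u, y = u *+ q.
Proof.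
move=> bd hy; apply: contrapT => /(exists_padic_dual bd)[h h1].
have [w] := hy h; rewrite h1 -mulr_natr.
(* Coordinate 0 is reduction modulo p, where 1 = p w becomes 1 = 0. *)
move/(congr1 (fun z : padic_int p => pcoord z 0%N)).
rewrite [RHS](_ : _ = pcoord w 0%N * pcoord q%:R 0%N) // pcoord_nat.
have : q%:R = 0 :> 'Z_(q ^ 1) by rewrite -[X in X%:R]expn1 pchar_Zp // primes_exp_gt1.
move=> ->; rewrite mulr0 => /(congr1 val).
by [].
Qed.

End PadicDualExistence.

(** * From divisibility of all dual values to divisibility in G *)

Lemma dual_divisible_divisible (G : zmodType) (n N : nat) (y : G) :
  torsion_free G ->
  (forall (p : primes_type) d (b : nat -> G), pindep p d b -> (d <= n)%N) ->
  (0 < N)%N ->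
  (forall (p : primes_type) (h : padic_dual G p), exists w, h y = w *+ N) ->
  exists x, y = x *+ N.
Proof.
move=> Gtf bd; elim/ltn_ind: N y => N IH y N0 hy.
have [N1|N1] := leqP N 1.
  by exists y; have -> : N = 1%N by apply/eqP; rewrite eqn_leq N1.
pose p : primes_type := exist _ (pdiv N) (pdiv_prime N1).
have pN : (N = N %/ val p * val p)%N by rewrite divnK // pdiv_dvd.
have N'0 : (0 < N %/ val p)%N.
  by rewrite divn_gt0 ?prime_gt0 ?(valP p) // dvdn_leq // pdiv_dvd.
have [|y' y'E] := padic_dual_dvdp (p := p) (y := y) Gtf (bd p).
  by move=> h; have [w ->] := hy p h; exists (w *+ (N %/ val p)); rewrite -mulrnA -pN.
have [||r h|x xE] := IH (N %/ val p)%N _ y' => //.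
- by rewrite ltn_Pdiv // prime_gt1 // (valP p).
- have [w hw] := hy r h; exists w.
  (* The prime p is nonzero in the domain Z_r for every prime r, so it cancels. *)
  apply: (@mulIf _ (val p)%:R); first by rewrite padic_natr_eq0 -lt0n prime_gt0 // (valP p).
  by rewrite !mulr_natr -raddfMn -y'E hw -mulrnA -pN.
- by exists x; rewrite y'E xE -mulrnA -pN.
Qed.

(** * Rational coordinates and p-adic integrality *)

Section RationalCoordinates.
Variables (G : zmodType) (n : nat) (g : 'I_n -> G).
Hypothesis Gtf : torsion_free G.
Hypothesis g_inj : injective g.
Hypothesis g_max : maximal_independent (range g).

(** A relation leaves the common denominator [N] free to be chosen in each use. *)
Definition coords (x : G) (v : 'cV[rat]_n) :=
  exists (N : nat) (z : 'cV[int]_n),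
    [/\ (0 < N)%N, x *+ N = zspan g z & v *+ N = map_mx intr z].

Lemma rat_cV_mulrn_eq0 (v : 'cV[rat]_n) (N : nat) : (0 < N)%N -> v *+ N = 0 -> v = 0.
Proof.
move=> N0 /eqP; rewrite -scaler_nat scaler_eq0 Num.Theory.pnatr_eq0.
by rewrite -[N == 0%N]negbK -lt0n N0 => /eqP.
Qed.

Lemma coords_exists x : exists v, coords x v.
Proof.
have [N [z [N0 xz]]] := torsion_over_zspan g_max x.
exists (N%:R^-1 *: map_mx intr z), N, z; split=> //.
by rewrite -scaler_nat scalerA mulfV ?scale1r // Num.Theory.pnatr_eq0 -lt0n.
Qed.

Lemma coordsB x y v w : coords x v -> coords y w -> coords (x - y) (v - w).
Proof.
move=> [N [z [N0 xz vz]]] [M [t [M0 yt wt]]].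
exists (N * M)%N, (z *+ M - t *+ N); split; first by rewrite muln_gt0 N0.
  by rewrite mulrnBl {2}mulnC !mulrnA xz yt raddfB !raddfMn.
by rewrite mulrnBl {2}mulnC !mulrnA vz wt map_mxB !raddfMn.
Qed.

Lemma coords0l v : coords 0 v -> v = 0.
Proof.
move=> [N [z [N0]]]; rewrite mul0rn => /esym/(zspan_eq0 g_inj g_max) ->.
by rewrite map_mx0 => /(rat_cV_mulrn_eq0 N0).
Qed.

Lemma coords0r x : coords x 0 -> x = 0.
Proof.
move=> [N [z [N0 xz]]]; rewrite mul0rn => z0; apply: (Gtf N0); rewrite xz.
suff -> : z = 0 by rewrite raddf0.
apply/matrixP => i j; apply: (@intr_inj rat).
by have := congr1 (fun B : 'cV_n => B i j) z0; rewrite !mxE => <-.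
Qed.

(* The first condition is padic_integral_at at p, stated for one matrix. *)
Lemma coords_integral (p : primes_type) (m : nat) (f : 'I_m -> padic_dual G p)
    (A : 'M[padic_int p]_(m, n)) N (y : G) (v : 'cV[rat]_n) (z : 'cV[int]_n) :
  A = \matrix_(i, j) f i (g j) -> (0 < N)%N ->
  y = zspan g z -> v *+ N = map_mx intr z ->
  (exists w : 'cV_m, map_mx (@tofrac _) A *m map_mx (@padic_of_rat p) v
       = map_mx (@tofrac _) w) <->
  (exists w : 'I_m -> padic_int p, forall i, f i y = w i *+ N).
Proof.
move=> AE N0 yz vz; set X := _ *m _.
(* Since N v is the integral vector [z], additivity of f_i gives N (A v)_i = f_i(y). *)
have XN i : X i 0 *+ N = tofrac (f i y).
  rewrite yz raddf_sum rmorph_sum /= /X mxE -sumrMnl; apply: eq_bigr => j _.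
  rewrite AE !mxE -mulrnAr -raddfMn raddfMz.
  have -> : v j 0 *+ N = (z j 0)%:~R.
    by have := congr1 (fun B : 'cV_n => B j 0) vz; rewrite mulmxnE !mxE.
  by rewrite /= /padic_of_rat ratr_int raddfMz mulrzr.
split=> [[w XE]|[w wE]].
  exists (fun i => w i 0) => i; apply/eqP; rewrite -tofrac_eq; apply/eqP.
  by rewrite -XN XE mxE raddfMn.
exists (\col_i w i); apply/matrixP => i j; rewrite ord1 [RHS]mxE [in RHS]mxE.
have N0' : N%:R != 0 :> padic_num p by rewrite (padic_num_intr_eq0 p N) -lt0n.
by apply: (mulIf N0'); rewrite !mulr_natr XN wE raddfMn.
Qed.

End RationalCoordinates.

Lemma padic_dual_sumE (G : zmodType) (p : primes_type) m (c : 'I_m -> padic_int p)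
    (f : 'I_m -> padic_dual G p) (x : G) :
  (\sum_i c i *: f i : padic_dual G p) x = \sum_i c i * f i x.
Proof.
exact: (big_morph (fun h : padic_dual G p => h x) (id1 := 0) (op1 := +%R)).
Qed.

(** * The coordinate isomorphism *)

Local Open Scope classical_set_scope.

Theorem proposition5p3
  (G : zmodType) (n : nat)
  (Gtf : torsion_free G) (Grk : has_rank G n)
  (g : 'I_n -> G) (g_inj : injective g) (g_max : maximal_independent (range g))
  (m : primes_type -> nat)
  (f : forall p : primes_type, 'I_(m p) -> padic_dual G p)
  (f_basis : forall p : primes_type, is_basis (f p))
  (A : forall p : primes_type, 'M[padic_int p]_(m p, n))
  (A_def : forall p : primes_type, A p = \matrix_(i < m p, j < n) f p i (g j)) :
  group_isomorphic G (matrix_group A).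
Proof.
have /choice[phi phiE] := coords_exists g_max.
have phiP x v : coords g x v -> phi x = v.
  move=> xv; apply/eqP; rewrite -subr_eq0; apply/eqP.
  by apply: (coords0l g_inj g_max); rewrite -(subrr x); apply: coordsB.
have phiB : zmod_morphism phi.
  by move=> x y; apply: phiP; apply: coordsB.
have phi_in x : phi x \in matrix_group_pred A.
  apply/asboolP => p; have [N [z [N0 xz vz]]] := phiE x.
  apply/(coords_integral (A_def p) N0 xz vz).
  (* Here y = N x, so f_i(y) = N f_i(x). *)
  by exists (f p ^~ x) => i; rewrite raddfMn.
pose psi x : matrix_group A := exist _ (phi x) (phi_in x).
have psiB : zmod_morphism psi.
  by move=> x y; apply: val_inj; rewrite raddfB /= phiB.
pose Psi : {additive G -> matrix_group A} :=
  HB.pack psi (GRing.isZmodMorphism.Build G (matrix_group A) psi psiB).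
exists Psi; rewrite -setTT_bijective; split.
- by [].
- move=> x y _ _ /(congr1 val) /= xy; apply/eqP; rewrite -subr_eq0; apply/eqP.
  by have := coordsB (phiE x) (phiE y); rewrite xy subrr => /(coords0r Gtf).
- move=> [v vA] _.
  (* Surjectivity: [N] clears the denominators of [v], and a preimage is an N-th part of the
     combination of g with coefficients N v. *)
  pose N := (\prod_(j < n) `|denq (v j ord0)|)%N.
  have N0 : (0 < N)%N by rewrite prodn_gt0 // => j; rewrite absz_gt0 denq_eq0.
  have /choice[z zE] (j : 'I_n) : exists z : int, v j 0 *+ N = z%:~R.
    exists (numq (v j 0) * (\prod_(l < n | l != j) `|denq (v l ord0)|)%N%:Z).
    rewrite rmorphM /= numqE -mulrA -rmorphM /= -mulr_natr; congr (_ * _).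
    by rewrite /N (bigD1 j) //= -[in RHS]absz_denq -PoszM -pmulrn.
  have vz : v *+ N = map_mx intr (\col_j z j).
    by apply/matrixP => j k; rewrite ord1 mulmxnE !mxE.
  have [x xE] : exists x, zspan g (\col_j z j) = x *+ N.
    apply: (dual_divisible_divisible Gtf _ N0) => [p d b|p h].
      exact: (pindep_leq_rank g_max).
    have /asboolP/(_ p) := vA.
    move=> /(coords_integral (A_def p) N0 erefl vz)[w wE].
    (* Integrality of A_p v gives divisibility only for the basis functionals; expanding [h] in the
       basis extends it to [h]. *)
    have [_ /(_ h)[c ->]] := f_basis p; exists (\sum_i c i * w i).
    rewrite padic_dual_sumE -sumrMnl; apply: eq_bigr => i _.
    by rewrite wE mulrnAr.
  exists x => //; apply: val_inj; apply: phiP.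
  by exists N, (\col_j z j).
Qed.
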